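(* Fix $F>0$ and $\phi$ as in the context (in particular $\phi''_F>0$, $\phi''_{2F}<0$ and $\phi''_F+5\phi''_{2F}>0$). Then there exist constants $h_0>0$ and $C>0$, with $C$ independent of $h$, $K$ and $p$, such that for all integers $N,K$ with $h=1/N\le h_0$ and $2\le K\le N-2$, and for all $1\le p\le\infty$, the solution $\mathbf{u}_{qc}$ of the quasicontinuum error equation $L^{qc,h}\mathbf{u}_{qc}-\mathbf{g}=\mathbf{0}$ (the unique mean-zero $2N$-periodic solution) satisfies $$\|\mathbf{u}_{qc}\|_{\ell^\infty_h}\le C h,\qquad \|\mathbf{u}_{qc}\|_{w^{1,p}_h}\le C h^{1/p},$$ where $h^{1/p}$ is read as $1$ when $p=\infty$.
   Context: Setting. $F>0$ is fixed, $\phi\in C^2([r_0,\infty))$ for some $0<r_0<F$, and $\phi'_F:=\phi'(F)$, $\phi''_F:=\phi''(F)$, $\phi'_{2F}:=\phi'(2F)$, $\phi''_{2F}:=\phi''(2F)$. Standing assumptions: $\phi''_F>0$, $\phi''_{2F}<0$, $\phi''_F+5\phi''_{2F}>0$. $N$ is a positive integer and $h=1/N$. Displacements are real sequences $(u_j)_{j\in\mathbb{Z}}$ with $u_{j+2N}=u_j$, identified with $\mathbf{u}=(u_{-N+1},\dots,u_N)$. Per-atom energies. Put $q_1(s)=\phi'_F s+\tfrac12\phi''_F s^2$, $q_2(s)=\phi'_{2F}s+\tfrac12\phi''_{2F}s^2$, $q_c(s)=(\phi'_F+2\phi'_{2F})s+\tfrac12(\phi''_F+4\phi''_{2F})s^2$,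 and $$\mathcal{E}^{a,h}_j(\mathbf{u})=\tfrac12\Big[q_1\big(\tfrac{u_{j+1}-u_j}{h}\big)+q_2\big(\tfrac{u_{j+2}-u_j}{h}\big)\Big]+\tfrac12\Big[q_1\big(\tfrac{u_j-u_{j-1}}{h}\big)+q_2\big(\tfrac{u_j-u_{j-2}}{h}\big)\Big],$$ $$\mathcal{E}^{c,h}_j(\mathbf{u})=\tfrac12 q_c\big(\tfrac{u_{j+1}-u_j}{h}\big)+\tfrac12 q_c\big(\tfrac{u_j-u_{j-1}}{h}\big).$$ Quasicontinuum energy with zero external force, for $2\le K\le N-2$ (atoms $-K,\dots,K$ are atomistic, the others in the period are continuum): $$\mathcal{E}^{qc,h}(\mathbf{u})=h\Big[\sum_{j=-N+1}^{-K-1}\mathcal{E}^{c,h}_j(\mathbf{u})+\sum_{j=-K}^{K}\mathcal{E}^{a,h}_j(\mathbf{u})+\sum_{j=K+1}^{N}\mathcal{E}^{c,h}_j(\mathbf{u})\Big].$$ This is a polynomial of degree at most two in $\mathbf{u}$; the linear operator $L^{qc,h}$ and the vector $\mathbf{g}$ (the ghost force) are defined by $$\frac1h\frac{\partial\mathcal{E}^{qc,h}}{\partial u_j}(\mathbf{u})=(L^{qc,h}\mathbf{u})_j-g_j\qquad(j=-N+1,\dots,N).$$ The equation $L^{qc,h}\mathbf{u}-\mathbf{g}=\mathbf{0}$ has solutions, unique up to an additive constant; $\mathbf{u}_{qc}$ denotes the one with $\sum_{j=-N+1}^N u_j=0$ (it is odd: $u_{-j}=-u_j$). Norms. With $u'_j=(u_{j+1}-u_j)/h$: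 for $1\le p<\infty$, $\|u\|_{\ell^p_h}=\big(\sum_{j=-N+1}^N h|u_j|^p\big)^{1/p}$; $\|u\|_{\ell^\infty_h}=\max_{-N+1\le j\le N}|u_j|$; and $\|u\|_{w^{1,p}_h}=\|u\|_{\ell^p_h}+\|u'\|_{\ell^p_h}$ for $1\le p\le\infty$. *)

(* Defs.v *)
From HB Require Import structures.
From mathcomp Require Import all_boot all_order all_algebra.
From mathcomp Require Import all_classical all_reals all_analysis.
From mathcomp Require Import ring lra zify.

Set Implicit Arguments.
Unset Strict Implicit.
Unset Printing Implicit Defensive.

Import Order.TTheory GRing.Theory Num.Theory.
Import numFieldNormedType.Exports.

Local Open Scope classical_set_scope.
Local Open Scope ring_scope.

(* The derivative is relative to [r0, +oo), hence one-sided at r0: [phi] is a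
   total function whose values left of r0 are irrelevant. *)
Definition has_derivative_on (R : realType) (r0 : R) (f df : R -> R) : Prop :=
  forall x, r0 <= x ->
    (fun y => (f y - f x) / (y - x)) @ within `[r0, +oo[ x^' --> df x.

Definition C2_on (R : realType) (r0 : R) (phi : R -> R) : Prop :=
  exists dphi ddphi : R -> R,
    [/\ has_derivative_on r0 phi dphi,
        has_derivative_on r0 dphi ddphi
      & {within `[r0, +oo[, continuous ddphi}].

Definition zrange (a b : int) : seq int :=
  if (a <= b)%R then [seq a + k%:Z | k <- iota 0 `|b - a|.+1] else [::].

Lemma mem_zrange (a b j : int) : (j \in zrange a b) = (a <= j <= b).
Proof.
rewrite /zrange; case: ifP => ab; last by apply/esym/negP => /andP[]; lia.
apply/mapP/idP => [[k]|jab].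
  by rewrite mem_iota add0n => /andP[_ kb] ->; apply/andP; split; lia.
exists `|j - a|%N; last by move/andP: jab => []; lia.
by rewrite mem_iota add0n /=; move/andP: jab => []; lia.
Qed.

Lemma zrange_uniq (a b : int) : uniq (zrange a b).
Proof.
rewrite /zrange; case: ifP => // _.
by rewrite map_inj_uniq ?iota_uniq // => x y /addrI [].
Qed.

Definition period (N : nat) : seq int := zrange (- N%:Z + 1) N%:Z.

Definition periodic (R : realType) (N : nat) (u : int -> R) : Prop :=
  forall j, u (j + (2 * N)%:Z) = u j.

Definition mesh (R : realType) (N : nat) : R := N%:R^-1.

Definition q1 (R : realType) (phi : R -> R) (F s : R) : R :=
  derive1 phi F * s + 2^-1 * derive1n 2 phi F * s ^+ 2.

Definition q2 (R : realType) (phi : R -> R) (F s : R) : R :=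
  derive1 phi (2 * F) * s + 2^-1 * derive1n 2 phi (2 * F) * s ^+ 2.

Definition qc (R : realType) (phi : R -> R) (F s : R) : R :=
  (derive1 phi F + 2 * derive1 phi (2 * F)) * s
  + 2^-1 * (derive1n 2 phi F + 4 * derive1n 2 phi (2 * F)) * s ^+ 2.

Definition Ea (R : realType) (phi : R -> R) (F : R) (N : nat) (j : int)
    (u : int -> R) : R :=
  let h := mesh R N in
  2^-1 * (q1 phi F ((u (j + 1) - u j) / h) + q2 phi F ((u (j + 2) - u j) / h))
  + 2^-1 * (q1 phi F ((u j - u (j - 1)) / h)
            + q2 phi F ((u j - u (j - 2)) / h)).

Definition Ec (R : realType) (phi : R -> R) (F : R) (N : nat) (j : int)
    (u : int -> R) : R :=
  let h := mesh R N in
  2^-1 * qc phi F ((u (j + 1) - u j) / h)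
  + 2^-1 * qc phi F ((u j - u (j - 1)) / h).

Definition Eqc (R : realType) (phi : R -> R) (F : R) (N K : nat)
    (u : int -> R) : R :=
  mesh R N *
  (\sum_(j <- zrange (- N%:Z + 1) (- K%:Z - 1)) Ec phi F N j u
   + \sum_(j <- zrange (- K%:Z) K%:Z) Ea phi F N j u
   + \sum_(j <- zrange (K%:Z + 1) N%:Z) Ec phi F N j u).

(* The coordinate vector e_j of R^(2N), extended 2N-periodically. *)
Definition pdelta (R : realType) (N : nat) (j : int) : int -> R :=
  fun k => (k == j %[mod (2 * N)%:Z])%Z%:R.

Definition partial (R : realType) (N : nat) (E : (int -> R) -> R) (j : int)
    (u : int -> R) : R :=
  derive1 (fun t : R => E (u + t *: pdelta R N j)) 0.

(* [EqcE] below, with [Lqc] linear, determines both operators: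
   evaluate it at u = 0. *)
Definition ghost (R : realType) (phi : R -> R) (F : R) (N K : nat) : int -> R :=
  fun j => - ((mesh R N)^-1 * partial N (Eqc phi F N K) j 0).

Definition Lqc (R : realType) (phi : R -> R) (F : R) (N K : nat)
    (u : int -> R) : int -> R :=
  fun j => (mesh R N)^-1 * partial N (Eqc phi F N K) j u + ghost phi F N K j.

Lemma EqcE (R : realType) (phi : R -> R) (F : R) (N K : nat) (u : int -> R)
    (j : int) :
  (mesh R N)^-1 * partial N (Eqc phi F N K) j u
  = Lqc phi F N K u j - ghost phi F N K j.
Proof. by rewrite /Lqc addrK. Qed.

(* [quad_along v E a] : along v, E is a quadratic polynomial whose linear
   coefficient [a u] is affine in the base point u. *)
Definition quad_along (R : realType) (v : int -> R) (E a : (int -> R) -> R) :=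
  (exists b, forall u (t : R), E (u + t *: v) = E u + t * a u + t ^+ 2 * b) /\
  (forall c u w, a (c *: u + w) = c * a u + a w - c * a 0).

Lemma quad_alongD (R : realType) (v : int -> R) E1 a1 E2 a2 :
  quad_along v E1 a1 -> quad_along v E2 a2 ->
  quad_along v (fun u => E1 u + E2 u) (fun u => a1 u + a2 u).
Proof.
move=> [[b1 H1] A1] [[b2 H2] A2]; split.
  by exists (b1 + b2) => u t; rewrite H1 H2; ring.
by move=> c u w; rewrite A1 A2; ring.
Qed.

Lemma quad_alongZ (R : realType) (v : int -> R) (k : R) E a :
  quad_along v E a -> quad_along v (fun u => k * E u) (fun u => k * a u).
Proof.
move=> [[b H] A]; split; first by exists (k * b) => u t; rewrite H; ring.
by move=> c u w; rewrite A; ring.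
Qed.

Lemma quad_along_sum (R : realType) (v : int -> R) (s : seq int)
    (E : int -> (int -> R) -> R) :
  (forall j, exists a, quad_along v (E j) a) ->
  exists a, quad_along v (fun u => \sum_(j <- s) E j u) a.
Proof.
move=> H; elim: s => [|j s [a IH]].
  exists (fun=> 0); split; last by move=> c u w; ring.
  by exists 0 => u t; rewrite !big_nil; ring.
have [a' Ha'] := H j; exists (fun u => a' u + a u).
rewrite (_ : (fun u => _) = fun u => E j u + \sum_(j <- s) E j u).
  exact: quad_alongD.
by apply/funext => u; rewrite big_cons.
Qed.

Lemma quad_along_bond (R : realType) (v : int -> R) (al be h : R) (i j : int) :
  exists a, quad_along v (fun u => al * ((u i - u j) / h)
                                   + 2^-1 * be * ((u i - u j) / h) ^+ 2) a.
Proof.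
exists (fun u => al * ((v i - v j) / h)
                 + be * ((u i - u j) / h) * ((v i - v j) / h)); split.
  exists (2^-1 * be * ((v i - v j) / h) ^+ 2) => u t.
  have -> : (u + t *: v) i = u i + t * v i by [].
  have -> : (u + t *: v) j = u j + t * v j by [].
  by move: h^-1 => k; field.
move=> c u w.
have -> : (c *: u + w) i = c * u i + w i by [].
have -> : (c *: u + w) j = c * u j + w j by [].
have -> : (0 : int -> R) i = 0 by [].
have -> : (0 : int -> R) j = 0 by [].
by ring.
Qed.

Lemma quad_along_Eqc (R : realType) (phi : R -> R) (F : R) (N K : nat) v :
  exists a, quad_along v (Eqc phi F N K) a.
Proof.
have HEc j : exists a, quad_along v (Ec phi F N j) a.
  have [a1 H1] := quad_along_bond v (derive1 phi F + 2 * derive1 phi (2 * F))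
    (derive1n 2 phi F + 4 * derive1n 2 phi (2 * F)) (mesh R N) (j + 1) j.
  have [a2 H2] := quad_along_bond v (derive1 phi F + 2 * derive1 phi (2 * F))
    (derive1n 2 phi F + 4 * derive1n 2 phi (2 * F)) (mesh R N) j (j - 1).
  by eexists; apply: quad_alongD; apply: quad_alongZ; [exact: H1|exact: H2].
have HEa j : exists a, quad_along v (Ea phi F N j) a.
  have B1 := quad_along_bond v (derive1 phi F) (derive1n 2 phi F) (mesh R N).
  have B2 := quad_along_bond v (derive1 phi (2 * F)) (derive1n 2 phi (2 * F)) (mesh R N).
  have [[a1 H1] [a2 H2]] := (B1 (j + 1) j, B2 (j + 2) j).
  have [[a3 H3] [a4 H4]] := (B1 j (j - 1), B2 j (j - 2)).
  eexists; apply: quad_alongD; apply: quad_alongZ; apply: quad_alongD;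
    [exact: H1|exact: H2|exact: H3|exact: H4].
have [a1 H1] := quad_along_sum (zrange (- N%:Z + 1) (- K%:Z - 1)) HEc.
have [a2 H2] := quad_along_sum (zrange (- K%:Z) K%:Z) HEa.
have [a3 H3] := quad_along_sum (zrange (K%:Z + 1) N%:Z) HEc.
eexists; apply: quad_alongZ; apply: quad_alongD; last exact: H3.
by apply: quad_alongD; [exact: H1|exact: H2].
Qed.

Lemma partial_quad (R : realType) (N : nat) (E a : (int -> R) -> R) (j : int) :
  quad_along (pdelta R N j) E a -> partial N E j = a.
Proof.
move=> [[b H] _]; apply/funext => u; rewrite /partial.
rewrite (_ : (fun t : R => _) = fun t => E u + t * a u + t ^+ 2 * b).
  rewrite derive1E.
  have D : is_derive (0 : R) (1 : R)
      (fun t : R => E u + t * a u + t ^+ 2 * b) (a u).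
    apply: is_derive_eq; rewrite /GRing.scale /=; ring.
  exact: derive_val.
by apply/funext => t; rewrite H.
Qed.

Lemma Lqc_linear (R : realType) (phi : R -> R) (F : R) (N K : nat) :
  linear (Lqc phi F N K).
Proof.
move=> c u w; apply/funext => j.
have -> : (c *: Lqc phi F N K u + Lqc phi F N K w) j
  = c * Lqc phi F N K u j + Lqc phi F N K w j by [].
have [a Ha] := quad_along_Eqc phi F N K (pdelta R N j).
rewrite /Lqc /ghost (partial_quad Ha) Ha.2; ring.
Qed.

Definition is_uqc (R : realType) (phi : R -> R) (F : R) (N K : nat)
    (u : int -> R) : Prop :=
  [/\ periodic N u,
      \sum_(j <- period N) u j = 0
    & forall j, j \in period N -> Lqc phi F N K u j - ghost phi F N K j = 0].

Definition fdiff (R : realType) (N : nat) (u : int -> R) : int -> R :=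
  fun j => (u (j + 1) - u j) / mesh R N.

(* Only used for 1 <= p; the value at p = -oo is a dummy. *)
Definition lnorm (R : realType) (N : nat) (p : \bar R) (u : int -> R) : R :=
  match p with
  | q%:E => (\sum_(j <- period N) mesh R N * `|u j| `^ q) `^ q^-1
  | +oo%E => \big[Num.max/0]_(j <- period N) `|u j|
  | -oo%E => 0
  end.

Definition w1norm (R : realType) (N : nat) (p : \bar R) (u : int -> R) : R :=
  lnorm N p u + lnorm N p (fdiff N u).

Definition root_mesh (R : realType) (N : nat) (p : \bar R) : R :=
  if p is q%:E then mesh R N `^ q^-1 else 1.

(* Main.v *)
Require Import Defs.
From HB Require Import structures.
From mathcomp Require Import all_boot all_order all_algebra.
From mathcomp Require Import all_classical all_reals all_analysis.
From mathcomp Require Import ring lra zify.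

Set Implicit Arguments.
Unset Strict Implicit.
Unset Printing Implicit Defensive.

Import Order.TTheory GRing.Theory Num.Theory.
Import numFieldNormedType.Exports.

Local Open Scope classical_set_scope.
Local Open Scope ring_scope.

(* With r = u', A = phi''_F and B = phi''_2F, the error equation says that the
   bond stress M r - phi'_2F e is a constant lam.  Here M is symmetric
   and cyclically tridiagonal, its off-diagonal entries are nonpositive, its row
   sums are A + 4B - 2B e_j, and e takes the values -1/2, 0, 1/2 around the left
   interface, 1/2, 0, -1/2 around the right one and 0 elsewhere.  Hence M is
   diagonally dominant with margin A + 5B > 0, so it is coercive in l^2 and in
   l^1.  As r has mean zero, lam drops out of the l^2 estimate, which bounds
   max |r|; summing the equation over all bonds bounds 2N lam = -2B <e, r>; the
   l^1 estimate then bounds the sum of |r_j| independently of N and K.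
   All norms follow by interpolation, since the oscillation of u is h times
   that sum. *)

(** * Sums of periodic sequences over one period *)

Lemma big_period (R : realType) (N : nat) (f : int -> R) :
  \sum_(j <- period N) f j
  = \sum_(0 <= k < 2 * N) f (- N%:Z + 1 + k%:Z).
Proof.
rewrite /period /zrange; case: ifP => NN; last first.
  have N0 : N = 0%N by lia.
  by rewrite N0 muln0 big_nil big_geq.
rewrite big_map /index_iota subn0.
by rewrite (_ : `|_|.+1 = 2 * N)%N //; lia.
Qed.

Lemma periodic_shift (R : realType) (N : nat) (f : int -> R) (k : int) :
  Defs.periodic N f -> Defs.periodic N (fun j => f (j + k)).
Proof. by move=> fp j; rewrite -(fp (j + k)); congr f; lia. Qed.

Lemma periodicD (R : realType) (N : nat) (f : int -> R) (j k : int) :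
  Defs.periodic N f -> f (j + (2 * N)%:Z + k) = f (j + k).
Proof. by move=> fp; rewrite addrAC fp. Qed.

Lemma sum_period_succ (R : realType) (N : nat) (f : int -> R) :
  Defs.periodic N f -> \sum_(j <- period N) f (j + 1)
    = \sum_(j <- period N) f j.
Proof.
move=> fp; rewrite !big_period; case: N fp => [|N] fp;
  first by rewrite !big_geq.
have -> : (2 * N.+1 = (2 * N).+2)%N by lia.
rewrite big_nat_recr //= [RHS]big_nat_recl //= [RHS]addrC; congr (_ + _).
  by apply: eq_bigr => k _; congr f; lia.
rewrite -[RHS]fp; congr f; lia.
Qed.

Lemma sum_period_pred (R : realType) (N : nat) (f : int -> R) :
  Defs.periodic N f -> \sum_(j <- period N) f (j - 1)
    = \sum_(j <- period N) f j.
Proof.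
move=> fp; rewrite -(sum_period_succ (periodic_shift (-1) fp)).
by apply: eq_bigr => j _; congr f; lia.
Qed.

Definition period_rep (N : nat) (j : int) : int :=
  ((j + N%:Z - 1) %% (2 * N)%:Z)%Z - N%:Z + 1.

Lemma period_repD (N : nat) (j : int) : period_rep N (j + (2 * N)%:Z)
  = period_rep N j.
Proof.
rewrite /period_rep (_ : _ - 1 = j + N%:Z - 1 + (2 * N)%:Z); last by lia.
by rewrite modzDr.
Qed.

Lemma period_rep_id (N : nat) (j : int) : j \in period N -> period_rep N j = j.
Proof.
rewrite /period mem_zrange /period_rep => /andP[? ?].
rewrite modz_small; lia.
Qed.

Lemma period_rep_period (N : nat) (j : int) : (0 < N)%N ->
  period_rep N j \in period N.
Proof.
move=> N0; rewrite mem_zrange /period_rep.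
have := ltz_pmod (j + N%:Z - 1) (_ : 0 < (2 * N)%:Z).
have := modz_ge0 (j + N%:Z - 1) (_ : (2 * N)%:Z != 0).
by lia.
Qed.

Lemma periodic_period_rep (R : realType) (N : nat) (f : int -> R) (j : int) :
  (0 < N)%N -> Defs.periodic N f -> f (period_rep N j) = f j.
Proof.
move=> N0 fp.
have fk (k : nat) i : f (i + k%:Z * (2 * N)%:Z) = f i.
  elim: k i => [|k IH] i; first by rewrite mul0r addr0.
  by rewrite -(IH i) -[RHS]fp intS mulrDl mul1r addrA addrAC.
have fz (k : int) i : f (i + k * (2 * N)%:Z) = f i.
  case: k => k; first exact: fk.
  by rewrite -(fk k.+1); rewrite NegzE mulNr addrNK.
rewrite -(fz ((j + N%:Z - 1) %/ (2 * N)%:Z)%Z (period_rep N j)); congr f.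
by rewrite /period_rep; have := divz_eq (j + N%:Z - 1) (2 * N)%:Z;
  set q := divz _ _; set r := modz _ _; set x := q * _; lia.
Qed.

(** * The atomistic indicator, the bond weights and the interface shape *)

(** Going through [period_rep] makes the indicator periodic, so that sums involving it can be
    shifted without boundary terms at the ends of the period. *)
Definition atomistic (R : realType) (N K : nat) (j : int) : R :=
  (`|period_rep N j| <= K)%N%:R.

Lemma atomistic_periodic (R : realType) (N K : nat) :
  Defs.periodic N (@atomistic R N K).
Proof. by move=> j; rewrite /atomistic period_repD. Qed.

Lemma atomistic_itv (R : realType) (N K : nat) (j : int) :
  0 <= atomistic R N K j <= 1.
Proof. by rewrite /atomistic; case: (_ <= _)%N; rewrite ler01 lexx. Qed.

(* With r = u', the energy is a sum over bonds in which q1 (r_j) has weight 1,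
   q2 (2 r_j) has weight [local_weight] and q2 (r_j + r_(j+1)) has weight
   [nonlocal_weight]; [chi] is the indicator of the atomistic region. *)
Definition local_weight (R : realType) (chi : int -> R) (j : int) : R :=
  1 - (chi j + chi (j + 1)) / 2.

Definition nonlocal_weight (R : realType) (chi : int -> R) (j : int) : R :=
  (chi j + chi (j + 2)) / 2.

(** This is the e of the overview. By [weights_sum] it is the deficit, relative to 2, of the total
    second-neighbour weight felt by bond j, and so it is nonzero only near an interface. *)
Definition ghost_shape (R : realType) (chi : int -> R) (j : int) : R :=
  (chi j + chi (j + 1) - chi (j - 1) - chi (j + 2)) / 2.

(** Row j of M r: the derivative in r_j of the quadratic part of the bond energy, in which r_j
    occurs in the pairs (j, j + 1) and (j - 1, j). *)
Definition stress (R : realType) (A B : R) (chi r : int -> R) (j : int) : R :=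
  (A + 4 * B * local_weight chi j) * r j
  + B * (nonlocal_weight chi j * (r j + r (j + 1))
    + nonlocal_weight chi (j - 1) * (r (j - 1) + r j)).

(* The upper bound on [j] is sharp: for K = N - 2 the atom N + 2 is the image
   of the atomistic atom - K. *)
Lemma atomistic_near (R : realType) (N K : nat) (j : int) :
  (2 <= K)%N -> (K <= N - 2)%N -> - N%:Z <= j -> j <= N%:Z + 1 ->
  atomistic R N K j = (`|j| <= K)%N%:R.
Proof.
move=> K2 KN j1 j2; rewrite /atomistic; congr (nat_of_bool _)%:R.
have [->|jN] := eqVneq j (- N%:Z).
  by rewrite -period_repD period_rep_id ?mem_zrange; lia.
have [jl|jg] := lerP j N%:Z; first by rewrite period_rep_id ?mem_zrange; lia.
rewrite (_ : j = j - (2 * N)%:Z + (2 * N)%:Z); last by lia.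
rewrite period_repD period_rep_id ?mem_zrange; lia.
Qed.

(** The value - 1 would need j - 1 and j + 2 atomistic with j and j + 1 continuum, whereas the
    continuum gap has 2N - 2K - 1 >= 3 atoms. The bound - 1/2 is what produces the margin A + 5B. *)
Lemma ghost_shape_ge (R : realType) (N K : nat) (j : int) :
  (0 < N)%N -> (2 <= K)%N -> (K <= N - 2)%N -> j \in period N ->
  - 2^-1 <= ghost_shape (atomistic R N K) j.
Proof.
rewrite mem_zrange /ghost_shape => N0 K2 KN /andP[j1 j2].
(* For j = N the atom j + 2 is beyond the range of [atomistic_near] and may be atomistic; there j -
   1 is continuum, and bounding the indicator at j + 2 by 1 suffices. *)
have [jN|jN] := eqVneq j N%:Z.
  have /andP[_ c1] := atomistic_itv R N K (j + 2).
  rewrite !(@atomistic_near _ _ _ j, @atomistic_near _ _ _ (j + 1),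
    @atomistic_near _ _ _ (j - 1)) //; try lia.
  have /negPf -> : ~~ (`|(j - 1)%R| <= K)%N by lia.
  have := ler0n R (`|j| <= K)%N; have := ler0n R (`|(j + 1)%R| <= K)%N;
    rewrite /=; lra.
rewrite !atomistic_near //; try lia.
have [?|?] := leqP `|j|%N K; have [?|?] := leqP `|(j + 1)%R|%N K;
  have [?|?] := leqP `|(j - 1)%R|%N K; have [?|?] := leqP `|(j + 2)%R|%N K;
    rewrite /=; try lra; exfalso; lia.
Qed.

Lemma sum_period_eq (R : realType) (N : nat) (a : int) :
  \sum_(j <- period N) (j == a)%:R <= 1 :> R.
Proof.
have [ap|ap] := boolP (a \in period N).
  rewrite (bigD1_seq a) ?zrange_uniq //= eqxx big1 ?addr0// => i /negPf ->.
  by [].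
rewrite big1_seq ?ler01// => i /andP[_ ip]; case: eqP => // ia.
by rewrite -ia ip in ap.
Qed.

(** Each e_j is half the difference of two jumps of the indicator, so the sum is at most the total
    variation of the indicator over a period; its only jumps, of size 1, are at the two
    interfaces. *)
Lemma ghost_shape_sum (R : realType) (N K : nat) :
  (0 < N)%N -> (2 <= K)%N -> (K <= N - 2)%N ->
  \sum_(j <- period N) `|ghost_shape (atomistic R N K) j| <= 2.
Proof.
move=> N0 K2 KN; set chi := atomistic R N K.
have cp : Defs.periodic N chi by exact: atomistic_periodic.
pose d j := `|chi (j + 1) - chi j|.
have dp : Defs.periodic N d.
  by move=> j; rewrite /d cp addrAC cp.
(* Both shifted halves add up to the variation, so it remains to compare termwise and to show that
   the variation is at most 2. *)
have -> : 2 = \sum_(j <- period N) (2^-1 * d (j - 1) + 2^-1 * d (j + 1))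
   + (2 - \sum_(j <- period N) d j) :> R.
  rewrite big_split /= -!mulr_sumr sum_period_pred // sum_period_succ //; lra.
rewrite -[leLHS]addr0 lerD //.
  apply: ler_sum => j _; rewrite /ghost_shape /d subrK -(addrA j).
  rewrite -mulrDr normrM (ger0_norm (_ : 0 <= 2^-1)) // mulrC ler_pM2l //.
  rewrite [X in _ <= _ + X]distrC.
  by rewrite (_ : _ - _ - _ = (chi j - chi (j - 1)) + (chi (j + 1) - chi (j
    + 2)));
    [exact: ler_normD|ring].
rewrite subr_ge0.
apply: (@le_trans _ _ (\sum_(j <- period N) ((j == - K%:Z - 1)%:R
  + (j == K%:Z)%:R))).
  rewrite big_seq [leRHS]big_seq; apply: ler_sum => j.
  rewrite mem_zrange /d => /andP[j1 j2]; rewrite /chi !atomistic_near //;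
    try lia.
  have [?|?] := leqP `|(j + 1)%R|%N K; have [?|?] := leqP `|j|%N K;
  case: eqP => ?; case: eqP => ?;
  rewrite /= ?subrr ?sub0r ?subr0 ?normrN ?normr0 ?normr1 ?addr0 ?add0r ?ler01
    ?lexx //; try lra; exfalso; lia.
rewrite big_split /=; have := sum_period_eq R N (- K%:Z - 1).
have := sum_period_eq R N K%:Z; lra.
Qed.

(** * Symmetry, row sums and coercivity of the stress operator *)

Lemma nonlocal_weight_periodic (R : realType) (N : nat) (chi : int -> R) :
  Defs.periodic N chi -> Defs.periodic N (nonlocal_weight chi).
Proof. by move=> cp j; rewrite /nonlocal_weight addrAC !cp. Qed.

Lemma sum_nonlocal_weight (R : realType) (N : nat) (chi f g : int -> R) :
  Defs.periodic N chi -> Defs.periodic N f -> Defs.periodic N g ->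
  \sum_(j <- period N) nonlocal_weight chi j * f j * (g j + g (j + 1))
  = \sum_(j <- period N) (nonlocal_weight chi j * f j
    + nonlocal_weight chi (j - 1) * f (j - 1)) * g j.
Proof.
move=> cp fp gp; have wp := nonlocal_weight_periodic cp.
under eq_bigr do rewrite mulrDr.
under [RHS]eq_bigr do rewrite mulrDl.
rewrite !big_split /=; congr (_ + _).
have qp : Defs.periodic N (fun j => nonlocal_weight chi j * f j * g (j + 1)).
  by move=> j; rewrite wp fp addrAC gp.
rewrite -(sum_period_pred qp).
by apply: eq_bigr => j _; rewrite subrK.
Qed.

(** Summation by parts exhibits the symmetry of M. It is used with s equal to r, to the sign of r,
    to 1, and to the difference quotient of a coordinate vector. *)
Lemma sum_stress (R : realType) (N : nat) (A B : R) (chi r s : int -> R) :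
  Defs.periodic N chi -> Defs.periodic N r -> Defs.periodic N s ->
  \sum_(j <- period N) stress A B chi r j * s j
  = \sum_(j <- period N)
      ((A + 4 * B * local_weight chi j) * r j * s j
       + B * (nonlocal_weight chi j * (r j + r (j + 1)) * (s j + s (j + 1)))).
Proof.
move=> cp rp sp; rewrite big_split /= -mulr_sumr.
have qp : Defs.periodic N (fun j => r j + r (j + 1)).
  by move=> j; rewrite addrAC !rp.
rewrite (sum_nonlocal_weight cp qp sp) mulr_sumr -big_split /=.
by apply: eq_bigr => j _; rewrite /stress subrK; ring.
Qed.

Lemma weights_sum (R : realType) (chi : int -> R) (j : int) :
  2 * local_weight chi j + nonlocal_weight chi j + nonlocal_weight chi (j - 1)
    = 2 - ghost_shape chi j.
Proof.
rewrite /local_weight /nonlocal_weight /ghost_shape (_ : j - 1 + 2 = j + 1);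
  last by lia.
by field.
Qed.

(** Moving the shift off f collects the coefficients of f_j into the row sum of M. It serves
    coercivity, with f = r s, and the summed equation, with f = r. *)
Lemma sum_stress_row (R : realType) (N : nat) (A B : R) (chi f : int -> R) :
  Defs.periodic N chi -> Defs.periodic N f ->
  \sum_(j <- period N) ((A + 4 * B * local_weight chi j) * f j
       + B * (nonlocal_weight chi j * (2 * (f j + f (j + 1)))))
  = \sum_(j <- period N) (A + 4 * B - 2 * B * ghost_shape chi j) * f j.
Proof.
move=> cp fp; have onep : Defs.periodic N (fun=> 1 : R) by [].
rewrite big_split /=.
have -> : \sum_(j <- period N) B * (nonlocal_weight chi j * (2 * (f j + f (j
  + 1))))
   = 2 * B * \sum_(j <- period N) nonlocal_weight chi j * 1 * (f j + f (j + 1)).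
  by rewrite mulr_sumr; apply: eq_bigr => j _; ring.
rewrite (sum_nonlocal_weight cp onep fp) mulr_sumr -big_split /=.
apply: eq_bigr => j _.
by have -> : ghost_shape chi j = 2 - (2 * local_weight chi j
  + nonlocal_weight chi j + nonlocal_weight chi (j - 1));
  [rewrite weights_sum; ring | ring].
Qed.

(** The last two hypotheses cover both s = r (l^2) and s = sign of r (l^1). Since B <= 0, bounding
    the pair products from above bounds the form from below, and only row sums remain. *)
Lemma stress_coercive (R : realType) (N : nat) (A B : R) (chi r s : int -> R) :
  Defs.periodic N chi -> Defs.periodic N r -> Defs.periodic N s ->
  B <= 0 -> (forall j, 0 <= chi j) ->
  (forall j, j \in period N -> - 2^-1 <= ghost_shape chi j) ->
  (forall j, 0 <= r j * s j) ->
  (forall j, (r j + r (j + 1)) * (s j + s (j + 1))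
             <= 2 * (r j * s j + r (j + 1) * s (j + 1))) ->
  (A + 5 * B) * \sum_(j <- period N) r j * s j
  <= \sum_(j <- period N) stress A B chi r j * s j.
Proof.
move=> cp rp sp B0 c0 ge rs0 rs2; rewrite sum_stress //.
have fp : Defs.periodic N (fun j => r j * s j) by move=> j; rewrite rp sp.
apply: (@le_trans _ _ (\sum_(j <- period N) ((A
  + 4 * B * local_weight chi j) * (r j * s j)
       + B * (nonlocal_weight chi j * (2 * (r j * s j + r (j + 1) * s (j
         + 1))))))); last first.
  apply: ler_sum => j _; rewrite -!mulrA lerD2l ler_wnM2l // ler_wpM2l
    ?ler_wpM2l //.
  by rewrite addr_ge0.
rewrite (sum_stress_row _ _ cp fp) mulr_sumr.
rewrite big_seq [leRHS]big_seq; apply: ler_sum => j jp.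
rewrite ler_wpM2r //.
(* From e_j >= - 1/2 and B <= 0 follows - 2B e_j >= B. *)
have := ge j jp; nra.
Qed.

Lemma sg_periodic (R : realType) (N : nat) (r : int -> R) :
  Defs.periodic N r -> Defs.periodic N (fun j => Num.sg (r j)).
Proof. by move=> rp j; rewrite rp. Qed.

(** The l^1 counterpart of (x + y)^2 <= 2 (x^2 + y^2): the sum of signs is at most 2 in absolute
    value, and |x + y| <= |x| + |y|. *)
Lemma mul_sg_le (R : realType) (x y : R) :
  (x + y) * (Num.sg x + Num.sg y) <= 2 * (x * Num.sg x + y * Num.sg y).
Proof.
have sgE (z : R) : `|Num.sg z| <= 1.
  by rewrite normr_sg lern1; case: (_ == _).
rewrite [x * _]mulrC [y * _]mulrC -!normrEsg.
apply: (le_trans (ler_norm _)); rewrite normrM mulrC ler_pM //.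
  apply: (le_trans (ler_normD _ _)).
  by rewrite -[2]/(1 + 1) lerD.
exact: ler_normD.
Qed.

(** * The a priori l^1 bound for the constant-stress equation *)

Lemma stress_apriori (R : realType) (N : nat) (A B lam b : R)
    (chi r : int -> R) :
  Defs.periodic N chi -> Defs.periodic N r ->
  B <= 0 -> 0 < A + 5 * B -> (forall j, 0 <= chi j <= 1) ->
  (forall j, j \in period N -> - 2^-1 <= ghost_shape chi j) ->
  \sum_(j <- period N) `|ghost_shape chi j| <= 2 ->
  \sum_(j <- period N) r j = 0 ->
  (forall j, j \in period N -> stress A B chi r j = lam
    + b * ghost_shape chi j) ->
  \sum_(j <- period N) `|r j|
  <= `|b| * ((2 - 8 * B / (A + 5 * B)) / (A + 5 * B)).
Proof.
move=> cp rp B0 d0 c01 ge gsum r0 eq; set d := A + 5 * B.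
have c0 j : 0 <= chi j by case/andP: (c01 j).
(* The l^2 estimate: paired with r, the constant [lam] disappears because r has mean zero. *)
have rle j : j \in period N -> `|r j| <= 2 * `|b| / d.
  move=> jp; rewrite ler_pdivlMr //.
  have h1 : d * \sum_(j <- period N) r j * r j
    <= `|b| * \sum_(j <- period N) `|ghost_shape chi j| * `|r j|.
    apply: le_trans (stress_coercive A cp rp rp B0 c0 ge _ _) _.
    - by move=> i; exact: sqr_ge0.
    - by move=> i; have := sqr_ge0 (r i - r (i + 1)); rewrite expr2; lra.
    rewrite (eq_big_seq (fun j => lam * r j + b * (ghost_shape chi j * r j)));
      last first.
      by move=> i /eq ->; ring.
    rewrite big_split /= -!mulr_sumr r0 mulr0 add0r.
    apply: le_trans (ler_norm _) _; rewrite normrM ler_wpM2l //.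
    apply: le_trans (ler_norm_sum _ _ _) _.
    by apply: ler_sum => i _; rewrite normrM.
  have h2 : d * \sum_(j <- period N) r j * r j <= `|b| ^+ 2 / d * 2.
    (* Young's inequality absorbs half of the left side; |e_j| <= 1 gives e_j^2 <= |e_j|, whose sum
       is at most 2. *)
    suff : `|b| * \sum_(j <- period N) `|ghost_shape chi j| * `|r j| <=
       \sum_(j <- period N) (d / 2 * (r j * r j)
         + `|b| ^+ 2 / (2 * d) * `|ghost_shape chi j|).
      rewrite big_split /= -!mulr_sumr => h3.
      have h4 := ler_wpM2l (_ : 0 <= `|b| ^+ 2 / (2 * d)) gsum.
      have := h4 (divr_ge0 (sqr_ge0 _) (mulr_ge0 (ler0n _ _) (ltW d0))).
      rewrite invfM.
      lra.
    rewrite mulr_sumr; apply: ler_sum => i _.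
    have g1 : `|ghost_shape chi i| <= 1.
      rewrite ler_norml /ghost_shape.
      have := c01 i; have := c01 (i + 1); have := c01 (i - 1);
        have := c01 (i + 2).
      lra.
    have -> : r i * r i = `|r i| ^+ 2 by rewrite real_normK ?num_real // expr2.
    have e1 : `|ghost_shape chi i| ^+ 2 <= `|ghost_shape chi i|.
      by rewrite expr2 ler_piMl.
    apply: (@le_trans _ _ (d / 2 * `|r i| ^+ 2
      + `|b| ^+ 2 / (2 * d) * `|ghost_shape chi i| ^+ 2)).
      rewrite -subr_ge0.
      have -> : d / 2 * `|r i| ^+ 2 + `|b| ^+ 2 / (2 * d) * `|ghost_shape chi i|
        ^+ 2 - `|b| * (`|ghost_shape chi i| * `|r i|)
        = (d * `|r i| - `|b| * `|ghost_shape chi i|) ^+ 2 / (2 * d) by (field;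
          rewrite gt_eqF).
      by rewrite divr_ge0 // ?sqr_ge0 // mulr_ge0 // ltW.
    by rewrite lerD2l ler_wpM2l // divr_ge0 // ?sqr_ge0 // mulr_ge0 // ltW.
  have h3 : `|r j| ^+ 2 <= \sum_(j <- period N) r j * r j.
    rewrite (bigD1_seq j) ?zrange_uniq //= real_normK ?num_real // expr2 lerDl.
    by apply: sumr_ge0 => i _; exact: sqr_ge0.
  (* The estimates give 2 b^2 on the right; it is rounded up to 4 b^2 to avoid a square root. *)
  have h4 : (`|r j| * d) ^+ 2 <= (2 * `|b|) ^+ 2.
    have h5 : d * (d * `|r j| ^+ 2) <= d * (`|b| ^+ 2 / d * 2).
      rewrite ler_pM2l //; by apply: le_trans _ h2; rewrite ler_wpM2l // ltW.
    have h6 : d * (`|b| ^+ 2 / d * 2) = 2 * `|b| ^+ 2 by (field;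
      rewrite gt_eqF).
    have -> : (`|r j| * d) ^+ 2 = d * (d * `|r j| ^+ 2) by ring.
    have := sqr_ge0 `|b|; have -> : (2 * `|b|) ^+ 2 = 4 * `|b| ^+ 2 by ring.
    lra.
  by rewrite -(@ler_sqr _ (`|r j| * d)) // nnegrE mulr_ge0 // ltW.
(* Summing the equation, e contributes nothing because its shifts of the indicator cancel. On the
   left the constant part of the row sums meets the zero mean of r, which leaves - 2B <e, r>,
   bounded by the maximum of |r| times the sum of |e_j|. *)
have lamle : `|\sum_(j <- period N) lam| <= - 8 * B * `|b| / d.
  have onep : Defs.periodic N (fun=> 1 : R) by [].
  have gs0 : \sum_(j <- period N) ghost_shape chi j = 0.
    rewrite /ghost_shape -mulr_suml !(big_split, sumrN) /=.
    have -> : \sum_(j <- period N) chi (j + 2) = \sum_(j <- period N) chi j.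
      rewrite -(sum_period_succ cp) -(sum_period_succ (periodic_shift 1 cp)).
      by apply: eq_bigr => i _; rewrite -addrA.
    rewrite (sum_period_succ cp) (sum_period_pred cp).
    by rewrite addrK subrr mul0r.
  have h : \sum_(j <- period N) lam
    = - 2 * B * \sum_(j <- period N) ghost_shape chi j * r j.
    transitivity (\sum_(j <- period N) stress A B chi r j * 1).
      rewrite [RHS](eq_big_seq (fun j => lam + b * ghost_shape chi j));
        last first.
        by move=> i /eq ->; rewrite mulr1.
      by rewrite [RHS]big_split /= -mulr_sumr gs0 mulr0 addr0.
    rewrite sum_stress //.
    rewrite (eq_bigr (fun j => (A + 4 * B * local_weight chi j) * r j
       + B * (nonlocal_weight chi j * (2 * (r j + r (j + 1))))));
         last by move=> i _; ring.
    rewrite sum_stress_row // mulr_sumr.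
    rewrite (eq_bigr (fun j => (A + 4 * B) * r j
      + (- 2 * B) * (ghost_shape chi j * r j))).
      by rewrite big_split /= -!mulr_sumr r0 mulr0 add0r.
    by move=> i _; ring.
  rewrite h normrM ger0_norm; last by lra.
  have -> : - 8 * B * `|b| / d = - 2 * B * (2 * `|b| / d * 2) by ring.
  rewrite ler_wpM2l //; first by lra.
  apply: le_trans (ler_norm_sum _ _ _) _.
  apply: (@le_trans _ _ (\sum_(j <- period N) (2 * `|b| / d) * `|ghost_shape chi
    j|)).
    rewrite big_seq [leRHS]big_seq; apply: ler_sum => i ip.
    by rewrite normrM mulrC ler_wpM2r // rle.
  rewrite -mulr_sumr ler_wpM2l // divr_ge0 ?mulr_ge0 // ltW //.
rewrite mulrA ler_pdivlMr // mulrC.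
(* The l^1 estimate: paired with the sign of r, the right side is at most the sum of |lam| + |b|
   |e_j|. *)
have E : \sum_(j <- period N) `|r j| = \sum_(j <- period N) r j * Num.sg (r j).
  by apply: eq_bigr => i _; rewrite mulrC -normrEsg.
rewrite E.
apply: le_trans (stress_coercive A cp rp (sg_periodic rp) B0 c0 ge _ _) _.
- by move=> i; rewrite mulrC -normrEsg.
- by move=> i; exact: mul_sg_le.
apply: (@le_trans _ _ (\sum_(j <- period N) (`|lam|
  + `|b| * `|ghost_shape chi j|))).
  rewrite big_seq [leRHS]big_seq; apply: ler_sum => i ip; rewrite eq //.
  apply: le_trans (ler_norm _) _; rewrite normrM.
  apply: (@le_trans _ _ `|lam + b * ghost_shape chi i|).
    rewrite ler_piMr // normr_sg lern1; by case: (_ == _).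
  by rewrite -normrM; exact: ler_normD.
rewrite big_split /= -mulr_sumr.
have -> : \sum_(j <- period N) `|lam| = `|\sum_(j <- period N) lam|.
  by rewrite !big_const_seq !iter_addr_0 normrMn.
have := ler_wpM2l (normr_ge0 b) gsum.
have -> : `|b| * (2 - 8 * B / d) = - 8 * B * `|b| / d + `|b| * 2 by ring.
by move=> ?; apply: lerD.
Qed.

(** * The energy as a sum over bonds, and its gradient *)

Lemma fdiff_periodic (R : realType) (N : nat) (u : int -> R) :
  Defs.periodic N u -> Defs.periodic N (fdiff N u).
Proof. by move=> up j; rewrite /fdiff addrAC !up. Qed.

Lemma fdiff_affine (R : realType) (N : nat) (u v : int -> R) (t : R) (j : int) :
  fdiff N (u + t *: v) j = fdiff N u j + t * fdiff N v j.
Proof.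
rewrite /fdiff.
have E i : (u + t *: v) i = u i + t * v i by [].
by rewrite !E; ring.
Qed.

Lemma mesh_gt0 (R : realType) (N : nat) : (0 < N)%N -> 0 < mesh R N.
Proof. by move=> N0; rewrite invr_gt0 ltr0n. Qed.

Lemma sum_period_telescope (R : realType) (N : nat) (f : int -> R) :
  Defs.periodic N f -> \sum_(j <- period N) (f (j - 1) - f j) = 0.
Proof. by move=> fp; rewrite big_split sumrN /= sum_period_pred // subrr. Qed.

Lemma sum_fdiff (R : realType) (N : nat) (u : int -> R) :
  Defs.periodic N u -> \sum_(j <- period N) fdiff N u j = 0.
Proof.
move=> up; rewrite -mulr_suml big_split sumrN /= sum_period_succ //.
by rewrite subrr mul0r.
Qed.

Lemma Eqc_sum (R : realType) (phi : R -> R) (F : R) (N K : nat) (u : int -> R) :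
  (2 <= K)%N -> (K <= N - 2)%N ->
  Eqc phi F N K u
  = mesh R N * \sum_(j <- period N)
      (atomistic R N K j * Ea phi F N j u
       + (1 - atomistic R N K j) * Ec phi F N j u).
Proof.
move=> K2 KN; rewrite /Eqc; congr (_ * _).
have -> : \sum_(j <- period N) (atomistic R N K j * Ea phi F N j u
       + (1 - atomistic R N K j) * Ec phi F N j u) =
  \sum_(j <- zrange (- N%:Z + 1) (- K%:Z - 1) ++ zrange (- K%:Z) K%:Z
              ++ zrange (K%:Z + 1) N%:Z) (atomistic R N K j * Ea phi F N j u
       + (1 - atomistic R N K j) * Ec phi F N j u).
  apply: perm_big; apply: uniq_perm; first exact: zrange_uniq.
    rewrite !cat_uniq !zrange_uniq /= !andbT; apply/andP; split.
      by apply/hasPn => j; rewrite mem_cat !mem_zrange; lia.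
    by apply/hasPn => j; rewrite !mem_zrange; lia.
  by move=> j; rewrite !mem_cat !mem_zrange; lia.
rewrite !big_cat /= -addrA; congr (_ + (_ + _)).
- apply: eq_big_seq => j; rewrite mem_zrange => /andP[j1 j2].
  rewrite atomistic_near; try lia.
  have /negPf -> : ~~ (`|j| <= K)%N by lia.
  by rewrite mul0r subr0 mul1r add0r.
- apply: eq_big_seq => j; rewrite mem_zrange => /andP[j1 j2].
  rewrite atomistic_near; try lia.
  have -> : (`|j| <= K)%N by lia.
  by rewrite mul1r subrr mul0r addr0.
- apply: eq_big_seq => j; rewrite mem_zrange => /andP[j1 j2].
  rewrite atomistic_near; try lia.
  have /negPf -> : ~~ (`|j| <= K)%N by lia.
  by rewrite mul0r subr0 mul1r add0r.
Qed.

(** Every bond energy is shared equally by its two end atoms, and q_c(s) = q1(s) + q2(2 s).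
    Regrouping by bonds therefore averages the indicator, or its complement, over the two ends. *)
Lemma Eqc_bonds (R : realType) (phi : R -> R) (F : R) (N K : nat)
    (u : int -> R) (chi := atomistic R N K) (r := fdiff N u) :
  (2 <= K)%N -> (K <= N - 2)%N -> Defs.periodic N u ->
  Eqc phi F N K u
  = mesh R N * \sum_(j <- period N)
      (q1 phi F (r j) + local_weight chi j * q2 phi F (2 * r j)
       + nonlocal_weight chi j * q2 phi F (r j + r (j + 1))).
Proof.
move=> K2 KN up; rewrite Eqc_sum //; congr (_ * _).
have cp : Defs.periodic N chi by exact: atomistic_periodic.
have rp : Defs.periodic N r by exact: fdiff_periodic.
pose y j := 2^-1 * (chi (j + 2) * q2 phi F (r j + r (j + 1))).
have yp : Defs.periodic N y.
  by move=> j; rewrite /y (periodicD _ _ cp) (periodicD _ _ rp) rp.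
(* The site and bond summands differ by X (j - 1) - X j, where [X] collects the halves owned by
   right ends. A second-neighbour half moves by two indices, hence the two terms in [y]. *)
pose X j := 2^-1 * q1 phi F (r j)
  + 2^-1 * ((1 - chi (j + 1)) * q2 phi F (2 * r j)) + y j + y (j - 1).
have Xp : Defs.periodic N X.
  by move=> j; rewrite /X (periodicD _ _ cp) (periodicD _ _ yp) rp yp.
rewrite -[RHS]addr0 -[X in _ = _ + X](sum_period_telescope Xp) -big_split /=.
apply: eq_bigr => j _.
have E1 : (u (j + 1) - u j) / mesh R N = r j by [].
have E2 : (u (j + 2) - u j) / mesh R N = r j + r (j + 1).
  by rewrite /r /fdiff -(addrA j) -mulrDl; congr (_ / _); ring.
have E3 : (u j - u (j - 1)) / mesh R N = r (j - 1) by rewrite /r /fdiff subrK.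
have E4 : (u j - u (j - 2)) / mesh R N = r (j - 1 - 1) + r (j - 1).
  rewrite /r /fdiff !subrK (_ : j - 1 - 1 = j - 2); last by lia.
  by rewrite -mulrDl; congr (_ / _); ring.
rewrite /Ea /Ec E1 E2 E3 E4 /X /y !subrK.
rewrite (_ : j - 1 + 2 = j + 1); last by lia.
rewrite (_ : j - 1 - 1 + 2 = j); last by lia.
rewrite /local_weight /nonlocal_weight /qc /q1 /q2 -/chi.
move: (derive1 phi F) (derive1 phi (2 * F)) (derive1n 2 phi F).
move: (derive1n 2 phi (2 * F)) (chi j) (chi (j + 1)) (chi (j + 2)).
move: (r j) (r (j + 1)) (r (j - 1)) (r (j - 1 - 1)) => *.
by field.
Qed.

Lemma partial_eq (R : realType) (N : nat) (E : (int -> R) -> R) (j : int)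
    (u : int -> R) (a b : R) :
  (forall t, E (u + t *: pdelta R N j) = E u + t * a + t ^+ 2 * b) ->
  partial N E j u = a.
Proof.
move=> H; rewrite /partial.
rewrite (_ : (fun t : R => _) = fun t => E u + t * a + t ^+ 2 * b); last first.
  by apply/funext => t; rewrite H.
rewrite derive1E.
have D : is_derive (0 : R) (1 : R) (fun t : R => E u + t * a + t ^+ 2 * b) a.
  by apply: is_derive_eq; rewrite /GRing.scale /=; ring.
exact: derive_val.
Qed.

Lemma pdelta_periodic (R : realType) (N : nat) (j : int) :
  Defs.periodic N (pdelta R N j).
Proof. by move=> k; rewrite /pdelta modzDr. Qed.

Lemma pdelta_period (R : realType) (N : nat) (j k : int) :
  j \in period N -> k \in period N -> pdelta R N j k = (k == j)%:R.
Proof.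
move=> jp kp; rewrite /pdelta; congr (nat_of_bool _)%:R.
apply/eqP/eqP => [E|-> //].
rewrite -(period_rep_id jp) -(period_rep_id kp) /period_rep; congr (_ - _ + _).
apply/eqP; rewrite -!(addrA _ N%:Z); rewrite eqz_modDr; exact/eqP.
Qed.

(** The derivative in r_j of the bond energy, less the constant phi'_F + 2 phi'_2F, which cancels in
    differences. *)
Definition bond_stress (R : realType) (phi : R -> R) (F : R) (N K : nat)
    (u : int -> R) (j : int) : R :=
  stress (derive1n 2 phi F) (derive1n 2 phi (2 * F)) (atomistic R N K)
    (fdiff N u) j
  - derive1 phi (2 * F) * ghost_shape (atomistic R N K) j.

Lemma ghost_shape_periodic (R : realType) (N : nat) (chi : int -> R) :
  Defs.periodic N chi -> Defs.periodic N (ghost_shape chi).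
Proof. by move=> cp j; rewrite /ghost_shape !(periodicD _ _ cp) cp. Qed.

Lemma stress_periodic (R : realType) (N : nat) (A B : R) (chi r : int -> R) :
  Defs.periodic N chi -> Defs.periodic N r ->
  Defs.periodic N (stress A B chi r).
Proof.
move=> cp rp j; have wp := nonlocal_weight_periodic cp.
by rewrite /stress /local_weight (periodicD _ _ cp) !(periodicD _ _ rp)
  (periodicD _ _ wp) cp rp wp.
Qed.

Lemma bond_stress_periodic (R : realType) (phi : R -> R) (F : R) (N K : nat)
    (u : int -> R) :
  Defs.periodic N u -> Defs.periodic N (bond_stress phi F N K u).
Proof.
move=> up j; have cp := @atomistic_periodic R N K.
by rewrite /bond_stress (ghost_shape_periodic cp) (stress_periodic _ _ cp
  (fdiff_periodic up)).
Qed.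

(** Chain rule: u_j enters r_(j-1) with slope 1/h and r_j with slope - 1/h, and the prefactor h of
    the energy cancels these. *)
Lemma partial_Eqc (R : realType) (phi : R -> R) (F : R) (N K : nat)
    (u : int -> R) (j : int) :
  (2 <= K)%N -> (K <= N - 2)%N -> Defs.periodic N u -> j \in period N ->
  partial N (Eqc phi F N K) j u
  = bond_stress phi F N K u (j - 1) - bond_stress phi F N K u j.
Proof.
move=> K2 KN up jp; have N0 : (0 < N)%N by lia.
set chi := atomistic R N K; set S := bond_stress phi F N K u.
have cp : Defs.periodic N chi by exact: atomistic_periodic.
set v := pdelta R N j; set r := fdiff N u; set s := fdiff N v.
have vp : Defs.periodic N v by exact: pdelta_periodic.
have rp : Defs.periodic N r by exact: fdiff_periodic.
have sp : Defs.periodic N s by exact: fdiff_periodic.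
have Sp : Defs.periodic N S by exact: bond_stress_periodic.
have SE : S (j - 1) - S j = mesh R N * \sum_(i <- period N) S i * s i.
  rewrite mulr_sumr.
  have Xp : Defs.periodic N (fun i => S i * v (i + 1)).
    by move=> i; rewrite Sp addrAC vp.
  rewrite (eq_bigr (fun i => S i * v (i + 1) - S i * v i)); last first.
    move=> i _; rewrite /s /fdiff; have := mesh_gt0 R N0; set h := mesh R N.
    by move=> h0; field; rewrite gt_eqF.
  rewrite big_split sumrN /= -(sum_period_pred Xp) -sumrN -big_split /=.
  rewrite (bigD1_seq j) ?zrange_uniq //= subrK big_seq_cond big1 ?addr0.
    by rewrite /v pdelta_period // eqxx !mulr1.
  move=> i /andP[ip /negPf ij]; rewrite subrK /v pdelta_period // ij.
  by rewrite !mulr0 subrr.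
set A := derive1n 2 phi F; set B := derive1n 2 phi (2 * F).
set a1 := derive1 phi F; set b1 := derive1 phi (2 * F).
(* The energy is exactly quadratic in t along v, and [b] is its coefficient of t^2. *)
pose b := mesh R N * \sum_(i <- period N) (2^-1 * (A * s i ^+ 2
   + local_weight chi i * (B * (2 * s i) ^+ 2)
     + nonlocal_weight chi i * (B * (s i + s (i + 1)) ^+ 2))).
rewrite SE; apply: (@partial_eq _ _ _ _ _ _ b) => t.
have uvp : Defs.periodic N (u + t *: v).
  have E i : (u + t *: v) i = u i + t * v i by [].
  by move=> i; rewrite !E up vp.
rewrite !Eqc_bonds // -/chi /b {b}.
rewrite [t * _]mulrCA [t ^+ 2 * _]mulrCA -!mulrDr; congr (_ * _).
have onep : Defs.periodic N (fun=> 1 : R) by [].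
have -> : \sum_(i <- period N) S i * s i
  = \sum_(i <- period N) ((a1 + A * r i) * s i + local_weight chi i * (2 * (b1
    + 2 * B * r i)) * s i
     + nonlocal_weight chi i * (b1 + B * (r i + r (i + 1))) * (s i + s (i
       + 1))).
  rewrite (eq_bigr (fun i => stress A B chi r i * s i
    + (- b1 * ghost_shape chi i * s i)));
    last by move=> i _; rewrite /S /bond_stress -/A -/B -/b1 -/chi -/r; ring.
  rewrite big_split /= sum_stress //.
  have -> : \sum_(i <- period N) - b1 * ghost_shape chi i * s i
     = \sum_(i <- period N) ((a1 + 2 * b1 * local_weight chi i) * s i
        + b1 * (nonlocal_weight chi i * 1 * (s i + s (i + 1)))).
    rewrite [RHS]big_split /= -mulr_sumr (sum_nonlocal_weight cp onep sp)
      mulr_sumr -big_split /=.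
    (* The constant [a1 + 2 * b1] drops out because s, a difference quotient, sums to zero. *)
    rewrite [RHS](eq_bigr (fun i => - b1 * ghost_shape chi i * s i + (a1
      + 2 * b1) * s i)).
      by rewrite big_split /= -[X in _ + X]mulr_sumr sum_fdiff // mulr0 addr0.
    move=> i _; have -> : ghost_shape chi i = 2 - (2 * local_weight chi i
      + nonlocal_weight chi i + nonlocal_weight chi (i - 1)).
      by rewrite weights_sum; ring.
    by ring.
  by rewrite -big_split /=; apply: eq_bigr => i _; ring.
rewrite !mulr_sumr -!big_split /=; apply: eq_bigr => i _.
rewrite !fdiff_affine -/r -/s /q1 /q2 -/A -/B -/a1 -/b1.
move: a1 b1 A B (local_weight chi i) (nonlocal_weight chi i) (r i) (r (i
  + 1)) (s i) (s (i + 1)) => *.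
by field.
Qed.

Lemma stress0 (R : realType) (A B : R) (chi : int -> R) (N : nat) (j : int) :
  stress A B chi (fdiff N 0) j = 0.
Proof.
have E i : fdiff N (0 : int -> R) i = 0.
  by rewrite /fdiff (_ : (0 : int -> R) _ = 0) // subrr mul0r.
by rewrite /stress !E; ring.
Qed.

Lemma ghostE (R : realType) (phi : R -> R) (F : R) (N K : nat) (j : int)
    (chi := atomistic R N K) :
  (2 <= K)%N -> (K <= N - 2)%N -> j \in period N ->
  ghost phi F N K j
  = (mesh R N)^-1 * (derive1 phi (2 * F) * (ghost_shape chi (j - 1) -
    ghost_shape chi j)).
Proof.
move=> K2 KN jp; rewrite /ghost partial_Eqc //.
by rewrite /bond_stress !stress0 -/chi; ring.
Qed.

Lemma LqcE (R : realType) (phi : R -> R) (F : R) (N K : nat) (u : int -> R)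
    (j : int)
    (S := stress (derive1n 2 phi F) (derive1n 2 phi (2 * F)) (atomistic R N K)
      (fdiff N u)) :
  (2 <= K)%N -> (K <= N - 2)%N -> Defs.periodic N u -> j \in period N ->
  Lqc phi F N K u j = (mesh R N)^-1 * (S (j - 1) - S j).
Proof.
move=> K2 KN up jp; rewrite /Lqc ghostE // partial_Eqc // /bond_stress -/S.
by ring.
Qed.

(** * Bounds on u' and u from the error equation *)

Lemma period_nat (N : nat) (j : int) :
  j \in period N -> exists2 k : nat, (k < 2 * N)%N & j = - N%:Z + 1 + k%:Z.
Proof.
by rewrite mem_zrange => /andP[? ?]; exists `|(j + N%:Z - 1)%R|%N; lia.
Qed.

Lemma mem_period (N k : nat) :
  (k < 2 * N)%N -> - N%:Z + 1 + k%:Z \in period N.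
Proof. by move=> ?; rewrite mem_zrange; lia. Qed.

Lemma const_on_period (R : realType) (N : nat) (f : int -> R) :
  (forall j, j \in period N -> f (j - 1) = f j) ->
  forall j, j \in period N -> f j = f (- N%:Z + 1).
Proof.
move=> H j /period_nat[k kN ->]; elim: k kN => [|k IH] kN;
  first by rewrite addr0.
rewrite -(IH (ltnW kN)) -(H _ (mem_period kN)); congr f; lia.
Qed.

(** The equation says that consecutive stresses agree, so the stress is a constant and
    [stress_apriori] applies. The case t = 1 bounds the solution, and t = 0 makes the kernel
    trivial. *)
Lemma sum_norm_fdiff_le (R : realType) (phi : R -> R) (F t : R) (N K : nat)
    (u : int -> R) (A := derive1n 2 phi F) (B := derive1n 2 phi (2 * F)) :
  B <= 0 -> 0 < A + 5 * B -> (2 <= K)%N -> (K <= N - 2)%N ->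
  Defs.periodic N u ->
  (forall j, j \in period N -> Lqc phi F N K u j - t * ghost phi F N K j = 0) ->
  \sum_(j <- period N) `|fdiff N u j|
  <= `|t * derive1 phi (2 * F)| * ((2 - 8 * B / (A + 5 * B)) / (A + 5 * B)).
Proof.
move=> B0 d0 K2 KN up eq; have N0 : (0 < N)%N by lia.
have cp := @atomistic_periodic R N K.
pose X j := stress A B (atomistic R N K) (fdiff N u) j
  - t * derive1 phi (2 * F) * ghost_shape (atomistic R N K) j.
have Xc j : j \in period N -> X j = X (- N%:Z + 1).
  apply: const_on_period => {}j jp; have := eq j jp.
  rewrite LqcE // ghostE // mulrCA -mulrBr => /eqP.
  rewrite mulf_eq0 invr_eq0 gt_eqF ?mesh_gt0 //= => /eqP E.
  by apply/eqP; rewrite -subr_eq0; apply/eqP; rewrite -[RHS]E /X -/A -/B; ring.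
apply: (@stress_apriori _ _ A B (X (- N%:Z + 1)) _ (atomistic R N K)) => //.
- exact: fdiff_periodic.
- exact: atomistic_itv.
- by move=> j; exact: ghost_shape_ge.
- exact: ghost_shape_sum.
- exact: sum_fdiff.
- by move=> j jp; rewrite -(Xc j jp) /X subrK.
Qed.

(** By mean zero, u_j is the average of the differences u_j - u_i. Each is compared through the
    first atom of the period, which costs the factor 2. *)
Lemma mean0_sup_le (R : realType) (N : nat) (u : int -> R) (j : int) :
  (0 < N)%N -> \sum_(j <- period N) u j = 0 -> j \in period N ->
  `|u j| <= 2 * mesh R N * \sum_(j <- period N) `|fdiff N u j|.
Proof.
move=> N0 u0 jp; have h0 := mesh_gt0 R N0.
set V := \sum_(j <- _) _.
have key i : i \in period N -> `|u i - u (- N%:Z + 1)| <= mesh R N * V.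
  move=> /period_nat[k kN ->].
  apply: (@le_trans _ _ (\sum_(0 <= l < k) mesh R N * `|fdiff N u (- N%:Z + 1
    + l%:Z)|)).
    elim: k {kN} => [|k IH]; first by rewrite big_geq // addr0 subrr normr0.
    rewrite big_nat_recr //=.
    have -> : mesh R N * `|fdiff N u (- N%:Z + 1 + k%:Z)|
      = `|u (- N%:Z + 1 + k.+1%:Z) - u (- N%:Z + 1 + k%:Z)|.
      rewrite -[X in X * _](gtr0_norm h0) -normrM /fdiff mulrC divfK ?gt_eqF //.
      by rewrite -addrA -[k.+1]addn1.
    rewrite -[X in `|X - _|](subrK (u (- N%:Z + 1 + k%:Z))) -addrA addrC.
    by apply: le_trans (ler_normD _ _) _; rewrite lerD2r.
  rewrite /V big_period -mulr_sumr ler_wpM2l ?(ltW h0) //.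
  rewrite [leRHS](big_cat_nat (leq0n k) (ltnW kN)) /=.
  by rewrite lerDl sumr_ge0.
have E : u j *+ (2 * N) = \sum_(i <- period N) (u j - u i).
  by rewrite big_split sumrN /= u0 oppr0 addr0 big_period big_const_nat subn0
    iter_addr_0.
have N2 : 0 < (2 * N)%:R :> R by rewrite ltr0n; lia.
rewrite -(ler_pM2r N2) -{1}(gtr0_norm N2) -normrM mulr_natr E.
apply: le_trans (ler_norm_sum _ _ _) _.
have -> : 2 * mesh R N * V * (2 * N)%:R
  = \sum_(i <- period N) (2 * mesh R N * V).
  by rewrite big_period big_const_nat subn0 iter_addr_0 mulr_natr.
rewrite big_seq [leRHS]big_seq; apply: ler_sum => i ip.
have -> : u j - u i = (u j - u (- N%:Z + 1)) - (u i - u (- N%:Z + 1)) by ring.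
apply: le_trans (ler_normB _ _) _.
have := key i ip; have := key j jp; rewrite -mulrA; lra.
Qed.

(** * Existence and uniqueness of the mean-zero solution *)

Lemma periodic_eq0 (R : realType) (N : nat) (u : int -> R) :
  (0 < N)%N -> Defs.periodic N u -> (forall j, j \in period N -> u j = 0) ->
  u = 0.
Proof.
move=> N0 up u0; apply/funext => j.
by rewrite -(periodic_period_rep j N0 up) u0 // period_rep_period.
Qed.

Lemma Lqc_ker (R : realType) (phi : R -> R) (F : R) (N K : nat)
    (u : int -> R) (A := derive1n 2 phi F) (B := derive1n 2 phi (2 * F)) :
  B <= 0 -> 0 < A + 5 * B -> (2 <= K)%N -> (K <= N - 2)%N ->
  Defs.periodic N u -> \sum_(j <- period N) u j = 0 ->
  (forall j, j \in period N -> Lqc phi F N K u j = 0) -> u = 0.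
Proof.
move=> B0 d0 K2 KN up u0 eq; have N0 : (0 < N)%N by lia.
apply: (periodic_eq0 N0 up) => j jp.
have V0 : \sum_(j <- period N) `|fdiff N u j| <= 0.
  have := @sum_norm_fdiff_le R phi F 0 N K u B0 d0 K2 KN up.
  rewrite !mul0r normr0 mul0r; apply=> i ip.
  by rewrite mul0r subr0 eq.
apply/eqP; rewrite -normr_le0; apply: le_trans (mean0_sup_le N0 u0 jp) _.
by rewrite pmulr_rle0 // mulr_gt0 // mesh_gt0.
Qed.

Lemma linear_inj_surj (F : fieldType) (n : nat) (f : 'rV[F]_n -> 'rV[F]_n) :
  linear f -> (forall x, f x = 0 -> x = 0) -> forall y, exists x, f x = y.
Proof.
move=> flin finj y.
pose fl : {linear 'rV[F]_n -> 'rV[F]_n} :=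
  HB.pack f (GRing.isLinear.Build F 'rV[F]_n 'rV[F]_n _ f flin).
have fE x : f x = x *m lin1_mx fl by rewrite mul_rV_lin1.
have free : row_free (lin1_mx fl).
  rewrite -kermx_eq0; apply/eqP/row_matrixP => i; rewrite row0.
  by apply: finj; rewrite fE -row_mul mulmx_ker row0.
exists (y *m invmx (lin1_mx fl)).
by rewrite fE mulmxKV // -row_free_unit.
Qed.

Definition periodic_ext (R : realType) (N : nat) (x : 'rV[R]_(2 * N)) : int ->
  R :=
  fun j => \sum_(i < 2 * N) x 0 i * pdelta R N (- N%:Z + 1 + i%:Z) j.

Lemma periodic_ext_linear (R : realType) (N : nat) : linear (@periodic_ext R N).
Proof.
move=> a x y; apply/funext => j.
have -> : (a *: periodic_ext x + periodic_ext y) j = a * periodic_ext x j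
  + periodic_ext y j by [].
rewrite /periodic_ext mulr_sumr -big_split /=; apply: eq_bigr => i _.
by rewrite !mxE; ring.
Qed.

Lemma periodic_ext_periodic (R : realType) (N : nat) (x : 'rV[R]_(2 * N)) :
  Defs.periodic N (periodic_ext x).
Proof.
by move=> j; apply: eq_bigr => i _; rewrite (pdelta_periodic R _).
Qed.

Lemma periodic_extE (R : realType) (N : nat) (x : 'rV[R]_(2 * N)) (k :
  'I_(2 * N)) :
  periodic_ext x (- N%:Z + 1 + k%:Z) = x 0 k.
Proof.
rewrite /periodic_ext (bigD1 k) //= pdelta_period ?mem_period // eqxx mulr1.
rewrite big1 ?addr0 // => i ik; rewrite pdelta_period ?mem_period //.
case: eqP => [|_]; last by rewrite mulr0.
by move=> /addrI[] /esym /ord_inj ki; rewrite ki eqxx in ik.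
Qed.

(* u |-> L u + (sum of u) is injective, and summing the equation
   L u + (sum of u) = g over a period gives sum of u = 0. *)
Lemma uqc_exists (R : realType) (phi : R -> R) (F : R) (N K : nat)
    (A := derive1n 2 phi F) (B := derive1n 2 phi (2 * F)) :
  B <= 0 -> 0 < A + 5 * B -> (2 <= K)%N -> (K <= N - 2)%N ->
  exists u, is_uqc phi F N K u.
Proof.
move=> B0 d0 K2 KN; have N0 : (0 < N)%N by lia.
pose m (x : 'rV[R]_(2 * N)) := \sum_(j <- period N) periodic_ext x j.
pose f x : 'rV[R]_(2 * N) :=
  \row_(i < 2 * N) (Lqc phi F N K (periodic_ext x) (- N%:Z + 1 + i%:Z) + m x).
have cp := @atomistic_periodic R N K.
have flin : linear f.
  move=> a x y; apply/rowP => i; rewrite !mxE periodic_ext_linear Lqc_linear.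
  have -> : m (a *: x + y) = a * m x + m y.
    by rewrite /m periodic_ext_linear mulr_sumr -big_split.
  have -> g w : (a *: g + w : int -> R) (- N%:Z + 1 + i%:Z)
    = a * g (- N%:Z + 1 + i%:Z) + w (- N%:Z + 1 + i%:Z) by [].
  by ring.
(* The case t = 0 serves the injectivity of [f], and t = 1 the solution itself. *)
have mE x (t : R) : (forall i : 'I_(2 * N), f x 0 i
  = t * ghost phi F N K (- N%:Z + 1 + i%:Z)) ->
    m x = 0 /\
    forall j, j \in period N -> Lqc phi F N K (periodic_ext x) j - t * ghost phi
      F N K j = 0.
  move=> fx.
  have eq j : j \in period N -> Lqc phi F N K (periodic_ext x) j + m x
    = t * ghost phi F N K j.
    by move=> /period_nat[k kN ->]; have := fx (Ordinal kN); rewrite mxE.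
  have m0 : m x = 0.
    have h0 := mesh_gt0 R N0.
    have sumL : \sum_(j <- period N) Lqc phi F N K (periodic_ext x) j = 0.
      rewrite (eq_big_seq _ (fun j => @LqcE R phi F N K _ j K2 KN
        (periodic_ext_periodic x))).
      rewrite -mulr_sumr sum_period_telescope ?mulr0 //.
      exact/stress_periodic/fdiff_periodic/periodic_ext_periodic.
    have sumg : \sum_(j <- period N) ghost phi F N K j = 0.
      rewrite (eq_big_seq _ (fun j => @ghostE R phi F N K j K2 KN)).
      rewrite -2!mulr_sumr sum_period_telescope ?mulr0 //.
      exact: ghost_shape_periodic.
    have : \sum_(j <- period N) (Lqc phi F N K (periodic_ext x) j + m x) = 0.
      by rewrite (eq_big_seq _ eq) -mulr_sumr sumg mulr0.
    rewrite big_split /= sumL add0r big_period big_const_nat subn0 iter_addr_0.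
    move=> /eqP; rewrite mulrn_eq0 muln_eq0 /= => /orP[/eqP|/eqP //]; lia.
  by split=> // j jp; rewrite -(eq j jp) m0 addr0 subrr.
have finj x : f x = 0 -> x = 0.
  move=> fx; have [|m0 L0] := mE x 0.
    by move=> i; rewrite fx mxE mul0r.
  have e0 : periodic_ext x = 0.
    apply: (Lqc_ker B0 d0 K2 KN (periodic_ext_periodic x) m0) => j jp.
    by rewrite -[RHS](L0 j jp) mul0r subr0.
  by apply/rowP => i; rewrite -periodic_extE e0 mxE.
have [x fx] := linear_inj_surj flin finj (\row_i ghost phi F N K (- N%:Z + 1
  + i%:Z)).
have [|m0 L0] := mE x 1.
  by move=> i; rewrite fx mxE mul1r.
exists (periodic_ext x); split => //; first exact: periodic_ext_periodic.
by move=> j jp; rewrite -[X in _ - X]mul1r L0.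
Qed.

Lemma uqc_unique (R : realType) (phi : R -> R) (F : R) (N K : nat)
    (u v : int -> R) (A := derive1n 2 phi F) (B := derive1n 2 phi (2 * F)) :
  B <= 0 -> 0 < A + 5 * B -> (2 <= K)%N -> (K <= N - 2)%N ->
  is_uqc phi F N K u -> is_uqc phi F N K v -> u = v.
Proof.
move=> B0 d0 K2 KN [up u0 uL] [vp v0 vL].
have E (g w : int -> R) j : (- 1 *: g + w : int -> R) j = w j - g j.
  by rewrite scaleN1r addrC.
suff : - 1 *: u + v = 0.
  by move=> h; apply/funext => j; have := E u v j; rewrite h => /esym/subr0_eq.
apply: (@Lqc_ker _ phi F N K) => //.
- by move=> j; rewrite !E up vp.
- by rewrite (eq_bigr _ (fun j _ => E u v j)) big_split sumrN /= u0 v0 subrr.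
move=> j jp; rewrite Lqc_linear E.
by rewrite (subr0_eq (uL j jp)) (subr0_eq (vL j jp)) subrr.
Qed.

(** * Interpolation to all exponents, and the theorem *)

(** The period has total mass 2N h = 2, so the norm is at most 2^(1/q) times 2 h T; then 2^(1/q) <=
    2, and h <= h^(1/q) since h <= 1. *)
Lemma lnorm_root_le (R : realType) (N : nat) (q T : R) (u : int -> R) :
  (0 < N)%N -> 1 <= q -> 0 <= T -> 
  (forall j, j \in period N -> `|u j| <= 2 * mesh R N * T) ->
  lnorm N q%:E u <= 4 * T * mesh R N `^ q^-1.
Proof.
move=> N0 q1 T0 uT; have h0 := mesh_gt0 R N0.
have q0 : 0 < q by lra.
have qV1 : q^-1 <= 1 by rewrite invf_le1.
have h1 : mesh R N <= 1.
  by rewrite invf_le1 ?ltr0n // ler1n.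
have hT : 0 <= 2 * mesh R N * T by rewrite !mulr_ge0 // ltW.
have hh : mesh R N <= mesh R N `^ q^-1.
  rewrite -[leLHS](powRr1 (ltW h0)); apply: ger_powR => //.
  by rewrite h0 h1.
apply: (@le_trans _ _ ((2 * (2 * mesh R N * T) `^ q) `^ q^-1)).
  apply: ge0_ler_powR.
  - by rewrite invr_ge0 ltW.
  - rewrite nnegrE; apply: sumr_ge0 => j _.
    by rewrite mulr_ge0 ?powR_ge0 // ltW.
  - by rewrite nnegrE mulr_ge0 ?powR_ge0.
  apply: (@le_trans _ _ (\sum_(j <- period N) mesh R N * (2 * mesh R N * T) `^
    q)).
    rewrite big_seq [leRHS]big_seq; apply: ler_sum => j jp.
    rewrite ler_pM2l //; apply: ge0_ler_powR; rewrite ?nnegrE ?uT //;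
      exact: ltW.
  rewrite big_period big_const_nat subn0 iter_addr_0 -mulrnAl.
  by rewrite /mesh -[N%:R^-1 *+ _]mulr_natl natrM mulfK // pnatr_eq0 -lt0n.
rewrite powRM ?powR_ge0 // -powRrM divff ?gt_eqF // powRr1 //.
have h2 : 2 `^ q^-1 <= 2 :> R.
  by rewrite -[leRHS](@powRr1 _ 2) //; apply: ler_powR => //; rewrite ler1n.
apply: (@le_trans _ _ (2 * (2 * mesh R N * T))); first by rewrite ler_wpM2r.
have := ler_wpM2l T0 hh; lra.
Qed.

(** Each |r_j| is at most T, so |r_j|^q <= |r_j| T^(q-1), and the weighted sum is at most h T^q. *)
Lemma lnorm_l1_le (R : realType) (N : nat) (q T : R) (r : int -> R) :
  (0 < N)%N -> 1 <= q -> 1 <= T -> \sum_(j <- period N) `|r j| <= T ->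
  lnorm N q%:E r <= T * mesh R N `^ q^-1.
Proof.
move=> N0 q1 T1 rT; have h0 := mesh_gt0 R N0.
have q0 : 0 < q by lra.
have T0 : 0 <= T by lra.
have -> : T * mesh R N `^ q^-1 = (mesh R N * T `^ q) `^ q^-1.
  rewrite powRM ?powR_ge0 //; last exact: ltW.
  by rewrite -powRrM divff ?gt_eqF // powRr1 // mulrC.
apply: ge0_ler_powR.
- by rewrite invr_ge0 ltW.
- rewrite nnegrE; apply: sumr_ge0 => j _.
  by rewrite mulr_ge0 ?powR_ge0 // ltW.
- by rewrite nnegrE mulr_ge0 ?powR_ge0 // ltW.
rewrite -mulr_sumr ler_pM2l //.
apply: (@le_trans _ _ (\sum_(j <- period N) `|r j| * T `^ (q - 1))).
  rewrite big_seq [leRHS]big_seq; apply: ler_sum => j jp.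
  have rjT : `|r j| <= T.
    apply: le_trans rT; rewrite (bigD1_seq j) ?zrange_uniq //= lerDl.
    exact: sumr_ge0.
  have [->|r0] := eqVneq (r j) 0.
    by rewrite normr0 mul0r powR0 // gt_eqF.
  rewrite -[q in leLHS](subrK 1) [`|r j| `^ _]powRD;
    last by rewrite normr_eq0 r0 implybT.
  rewrite powRr1 //.
  rewrite mulrC ler_wpM2l //.
  by apply: ge0_ler_powR; rewrite ?nnegrE // subr_ge0.
rewrite -mulr_suml -[q in leRHS](subrK 1) [T `^ (q - 1 + 1)]powRD; last first.
  by rewrite (gt_eqF (lt_le_trans ltr01 T1)) implybT.
by rewrite powRr1 // mulrC ler_wpM2l ?powR_ge0.
Qed.

(** The 5 is 4 from u plus 1 from u'; for p infinite, 2 h T + T <= 3 T is enough. *)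
Lemma mean0_norms_le (R : realType) (N : nat) (T : R) (u : int -> R)
    (p : \bar R) :
  (0 < N)%N -> 1 <= T -> \sum_(j <- period N) u j = 0 ->
  \sum_(j <- period N) `|fdiff N u j| <= T -> (1%:E <= p)%E ->
  lnorm N +oo%E u <= 5 * T * mesh R N /\ w1norm N p u <= 5 * T * root_mesh N p.
Proof.
move=> N0 T1 u0 VT p1; have h0 := mesh_gt0 R N0.
have T0 : 0 <= T by exact: le_trans ler01 T1.
have h1 : mesh R N <= 1 by rewrite invf_le1 ?ltr0n // ler1n.
have uT j : j \in period N -> `|u j| <= 2 * mesh R N * T.
  move=> jp; apply: le_trans (mean0_sup_le N0 u0 jp) _.
  by rewrite ler_wpM2l // mulr_ge0 // ltW.
have uoo : lnorm N +oo%E u <= 2 * mesh R N * T.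
  rewrite /lnorm big_seq; apply: bigmax_le => //.
  by rewrite !mulr_ge0 ?(ltW h0).
split.
  by apply: le_trans uoo _; rewrite mulrAC ler_wpM2r ?(ltW h0) // ler_wpM2r //
    ler_nat.
case: p p1 => [q| |]; [rewrite lee_fin => q1| |by []].
  apply: le_trans (lerD (lnorm_root_le N0 q1 T0 uT) (lnorm_l1_le N0 q1 T1 VT))
    _.
  by rewrite -mulrDl (_ : 4 * T + T = 5 * T) //; ring.
move=> _.
have roo : lnorm N +oo%E (fdiff N u) <= T.
  rewrite /lnorm big_seq; apply: bigmax_le => // j jp.
  apply: le_trans VT; rewrite (bigD1_seq j) ?zrange_uniq //= lerDl.
  exact: sumr_ge0.
apply: le_trans (lerD uoo roo) _; rewrite mulr1.
have := ler_wpM2r T0 h1; rewrite mul1r => hT.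
have -> : 2 * mesh R N * T + T = 2 * (mesh R N * T) + T by ring.
by move: (mesh R N * T) hT => x; lra.
Qed.

Theorem theorem3p1 (R : realType) (F r0 : R) (phi : R -> R)
    (F_gt0 : 0 < F) (r0_gt0 : 0 < r0) (r0_ltF : r0 < F)
    (phi_C2 : C2_on r0 phi)
    (ddphiF : 0 < derive1n 2 phi F)
    (ddphi2F : derive1n 2 phi (2 * F) < 0)
    (ddphiF2F : 0 < derive1n 2 phi F + 5 * derive1n 2 phi (2 * F)) :
  exists h0 C : R, [/\ 0 < h0, 0 < C &
    forall N K : nat,
      (0 < N)%N -> mesh R N <= h0 -> (2 <= K)%N -> (K <= N - 2)%N ->
      (exists! u : int -> R, is_uqc phi F N K u) /\
      forall u : int -> R, is_uqc phi F N K u ->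
      forall p : \bar R, (1%:E <= p)%E ->
        lnorm N +oo%E u <= C * mesh R N /\
        w1norm N p u <= C * root_mesh N p].
Proof.
have B0 := ltW ddphi2F.
set c := (2 - 8 * derive1n 2 phi (2 * F) / (derive1n 2 phi F
  + 5 * derive1n 2 phi (2 * F)))
  / (derive1n 2 phi F + 5 * derive1n 2 phi (2 * F)).
have c0 : 0 <= c.
  rewrite divr_ge0 ?ltW // subr_gt0 ltr_pdivrMr //; lra.
(* [T] bounds the sum of |u'_j| uniformly in N and K; the added 1 meets the condition 1 <= T of
   [mean0_norms_le]. *)
have [T [T1 bT]] : exists T, 1 <= T /\ `|derive1 phi (2 * F)| * c <= T.
  by exists (1 + `|derive1 phi (2 * F)| * c); rewrite lerDl lerDr mulr_ge0.
exists 1, (5 * T); split; first exact: ltr01.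
  by rewrite mulr_gt0 // (lt_le_trans ltr01 T1).
move=> N K N0 h1 K2 KN; split.
  have [u uP] := uqc_exists B0 ddphiF2F K2 KN.
  by exists u; split=> // v vP; exact: uqc_unique uP vP.
move=> u [up u0 uL] p p1.
have VT : \sum_(j <- period N) `|fdiff N u j| <= T.
  have u1 j : j \in period N ->
      Lqc phi F N K u j - 1 * ghost phi F N K j = 0.
    by move=> jp; rewrite mul1r uL.
  apply: le_trans (sum_norm_fdiff_le B0 ddphiF2F K2 KN up u1) _.
  by rewrite mul1r.
exact: mean0_norms_le.
Qed.
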